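(* Let $\mathfrak{X}=(X,f,n)$ be a face-edge-constraint net, equipped with its associated intrinsic net data, frames $p_i$, unit quaternions $g_i$, spinor connection $g_{ij}=g_i\cdot h_{ij}\cdot g_j^{-1}$, intrinsic Dirac operator $D$ and constant spinor field $\phi_c=(c,1)$ (given in the frame $p_i$ by the quaternion $g_i$). Then $$D(\phi_c)=\mathbf{H}\,\phi_c,$$ and the face-edge-constraint realization of the intrinsic data with respect to $\phi_c$ recovers $\mathfrak{X}$, i.e. $\overline{g_i}\cdot\mathfrak{e}^i_{ij}\cdot g_{ij}\cdot g_j=E_{ij}$ and $g_i^{-1}\cdot\mathbf{k}\cdot g_i=n_i$. Moreover $$\mathfrak{c}\circ(D-\mathbf{H})\circ\mathfrak{c}^{-1}=D_f ,$$ where $\mathfrak{c}:\Gamma(\mathcal{S})\to\{F\to\mathbb{H}\}$, $(c,\phi_i)\mapsto\phi_i$, and $\mathbf{H}$ acts by multiplication with $\mathbf{H}_i$ on each face.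
   Context: $\mathbb{H}$ has units $\mathbf{i},\mathbf{j},\mathbf{k}$; $\mathbb{R}^3=\mathrm{Im}(\mathbb{H})$. Oriented net: $X=(V,E,F)$ is a connected cell complex decomposing an oriented surface into polygonal faces; two adjacent faces share exactly one edge, and every edge is shared by exactly two faces. Edges of each face carry its boundary orientation. For $f:V\to\mathbb{R}^3$ and adjacent faces $\Delta_i,\Delta_j$, $df_{ij}\in\mathrm{Im}(\mathbb{H})$ is the edge vector of the common edge oriented as in $\Delta_i$ ($df_{ij}=-df_{ji}$). Face-edge-constraint net: $(X,f,n)$ with $n:F\to\mathbb{S}^2$ and $n_i+n_j\perp df_{ij}$ for all adjacent faces. It is assumed that $df_{ij}\ne0$, $n_i\nparallel df_{ij}$, and the dihedral angle $\theta_{ij}\in(-\pi,\pi)$, the angle of the right-handed rotation about $df_{ij}$ taking the half-plane $\mathbb{R}\,df_{ij}+\mathbb{R}_{>0}n_i$ to $\mathbb{R}\,df_{ij}+\mathbb{R}_{>0}n_j$. Integrated mean curvature: $\mathbf{H}_{ij}=\tfrac12|df_{ij}|\tan\tfrac{\theta_{ij}}2$, $\mathbf{H}_i=\sum_j\mathbf{H}_{ij}$. Hyperedge: $E_{ij}=2\mathbf{H}_{ij}+df_{ij}$. Extrinsic Dirac operator on $\phi:F\to\mathbb{H}$: $D_f(\phi)|_i=\tfrac12\sum_jE_{ij}(\phi_j-\phi_i)=\tfrac12\sum_jE_{ij}\phi_j-\mathbf{H}_i\phi_i$. All sums run over the faces adjacent to $\Delta_i$. Associated intrinsic data: $\mathrm{Affine}(\Delta_i)$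 is the plane perpendicular to $n_i$ (oriented by $n_i$), and the edge shared with $\Delta_j$ is assigned the vector $$e^i_{ij}=|E_{ij}|\,\frac{df_{ij}-\langle df_{ij},n_i\rangle n_i}{|df_{ij}-\langle df_{ij},n_i\rangle n_i|}.$$ Set $h_{ij}=(e^i_{ij})^{-1}E_{ij}$, a unit quaternion. Choose for each face an oriented orthonormal frame $p_i$ of the plane; let $\mathfrak{e}^i_{ij}\in\mathrm{span}\{\mathbf{i},\mathbf{j}\}$ be the vector with the same coordinates with respect to $p_i$ as $e^i_{ij}$, and choose a unit quaternion $g_i$ whose conjugation realizes the frame, i.e. $e^i_{ij}=g_i^{-1}\mathfrak{e}^i_{ij}g_i$ for all $j$ and $n_i=g_i^{-1}\mathbf{k}g_i$. The spinor connection is $g_{ij}=g_ih_{ij}g_j^{-1}$ (here only the vectors are used; no convexity condition on the faces is needed). Sections of the spinor bundle $\mathcal{S}$: a section $\psi\in\Gamma(\mathcal{S})$ is given in the frames $p_i$ by a map $F\to\mathbb{H}$, $i\mapsto\psi_i$ (written $(p_i,\psi_i)$), and the intrinsic Dirac operator is $(D\psi)_i=\tfrac12\sum_j\mathfrak{e}^i_{ij}\cdot g_{ij}\cdot\psi_j$. The constant frame is $c=p_i\cdot g_i$, so the section written $(c,\phi_i)$ equals $(p_i,g_i\phi_i)$. *)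

(* Defs.v *)
From HB Require Import structures.
From mathcomp Require Import all_boot all_order all_algebra.
From mathcomp Require Import ring.
From mathcomp Require Import boolp classical_sets functions reals trigo.

Set Implicit Arguments.
Unset Strict Implicit.
Unset Printing Implicit Defensive.

Import Order.TTheory GRing.Theory Num.Theory.

Local Open Scope ring_scope.

Record quat (R : Type) := Quat { q_re : R; q_i : R; q_j : R; q_k : R }.

Definition quat_tuple (R : Type) (q : quat R) : R * R * R * R :=
  (q_re q, q_i q, q_j q, q_k q).

Definition tuple_quat (R : Type) (t : R * R * R * R) : quat R :=
  let: (a, b, c, d) := t in Quat a b c d.

Lemma quat_tupleK (R : Type) : cancel (@quat_tuple R) (@tuple_quat R).
Proof. by case. Qed.

HB.instance Definition _ (R : realType) :=
  Choice.copy (quat R) (can_type (@quat_tupleK R)).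

Definition qadd (R : realType) (p q : quat R) : quat R :=
  Quat (q_re p + q_re q) (q_i p + q_i q) (q_j p + q_j q) (q_k p + q_k q).

Definition qopp (R : realType) (q : quat R) : quat R :=
  Quat (- q_re q) (- q_i q) (- q_j q) (- q_k q).

Definition qmul (R : realType) (p q : quat R) : quat R :=
  let: Quat a1 b1 c1 d1 := p in
  let: Quat a2 b2 c2 d2 := q in
  Quat (a1 * a2 - b1 * b2 - c1 * c2 - d1 * d2)
       (a1 * b2 + b1 * a2 + c1 * d2 - d1 * c2)
       (a1 * c2 - b1 * d2 + c1 * a2 + d1 * b2)
       (a1 * d2 + b1 * c2 - c1 * b2 + d1 * a2).

Definition qscale (R : realType) (s : R) (q : quat R) : quat R :=
  Quat (s * q_re q) (s * q_i q) (s * q_j q) (s * q_k q).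

Definition qconj (R : realType) (q : quat R) : quat R :=
  Quat (q_re q) (- q_i q) (- q_j q) (- q_k q).

Definition qdot (R : realType) (p q : quat R) : R :=
  q_re p * q_re q + q_i p * q_i q + q_j p * q_j q + q_k p * q_k q.

Definition qnorm (R : realType) (q : quat R) : R := Num.sqrt (qdot q q).

Definition qinv (R : realType) (q : quat R) : quat R :=
  qscale (qdot q q)^-1 (qconj q).

Lemma qaddA (R : realType) : associative (@qadd R).
Proof. by move=> [????] [????] [????]; rewrite /qadd /= !addrA. Qed.

Lemma qaddC (R : realType) : commutative (@qadd R).
Proof. by move=> [????] [????]; congr Quat; apply: addrC. Qed.

Lemma qadd0 (R : realType) : left_id (Quat 0 0 0 0) (@qadd R).
Proof. by move=> [????]; rewrite /qadd /= !add0r. Qed.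

Lemma qaddN (R : realType) : left_inverse (Quat 0 0 0 0) (@qopp R) (@qadd R).
Proof. by move=> [????]; rewrite /qadd /= !addNr. Qed.

HB.instance Definition _ (R : realType) := GRing.isZmodule.Build (quat R)
  (@qaddA R) (@qaddC R) (@qadd0 R) (@qaddN R).

Lemma qmulA (R : realType) : associative (@qmul R).
Proof. by move=> [????] [????] [????]; congr Quat => /=; ring. Qed.

Lemma qmul1l (R : realType) : left_id (Quat 1 0 0 0) (@qmul R).
Proof. by move=> [????]; congr Quat => /=; ring. Qed.

Lemma qmul1r (R : realType) : right_id (Quat 1 0 0 0) (@qmul R).
Proof. by move=> [????]; congr Quat => /=; ring. Qed.

Lemma qmulDl (R : realType) : left_distributive (@qmul R) +%R.
Proof. by move=> [????] [????] [????]; congr Quat => /=; ring. Qed.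

Lemma qmulDr (R : realType) : right_distributive (@qmul R) +%R.
Proof. by move=> [????] [????] [????]; congr Quat => /=; ring. Qed.

Lemma qone_neq0 (R : realType) : Quat 1 0 0 0 != 0 :> quat R.
Proof. by apply/eqP => -[] /eqP; rewrite oner_eq0. Qed.

HB.instance Definition _ (R : realType) := GRing.Zmodule_isNzRing.Build (quat R)
  (@qmulA R) (@qmul1l R) (@qmul1r R) (@qmulDl R) (@qmulDr R) (@qone_neq0 R).

Lemma qscaleA (R : realType) (a b : R) (q : quat R) :
  qscale a (qscale b q) = qscale (a * b) q.
Proof. by rewrite /qscale /= !mulrA. Qed.

Lemma qscale1 (R : realType) : left_id 1 (@qscale R).
Proof. by move=> [????]; rewrite /qscale /= !mul1r. Qed.

Lemma qscaleDr (R : realType) : right_distributive (@qscale R) +%R.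
Proof. by move=> a [????] [????]; congr Quat; apply: mulrDr. Qed.

Lemma qscaleDl (R : realType) (q : quat R) :
  {morph (fun a => qscale a q) : a b / a + b}.
Proof. by move=> a b; congr Quat; apply: mulrDl. Qed.

HB.instance Definition _ (R : realType) :=
  GRing.Zmodule_isLmodule.Build R (quat R)
    (@qscaleA R) (@qscale1 R) (@qscaleDr R) (@qscaleDl R).

Lemma qscaleAl (R : realType) (a : R) (p q : quat R) :
  a *: (p * q) = (a *: p) * q.
Proof. by case: p q => [????] [????]; congr Quat => /=; ring. Qed.

HB.instance Definition _ (R : realType) :=
  GRing.Lmodule_isLalgebra.Build R (quat R) (@qscaleAl R).

Lemma qscaleAr (R : realType) (a : R) (p q : quat R) :
  a *: (p * q) = p * (a *: q).
Proof. by case: p q => [????] [????]; congr Quat => /=; ring. Qed.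

HB.instance Definition _ (R : realType) :=
  GRing.Lalgebra_isAlgebra.Build R (quat R) (@qscaleAr R).

Lemma qdot_eq0 (R : realType) (q : quat R) : (qdot q q == 0) = (q == 0).
Proof.
apply/eqP/eqP => [|->]; last by rewrite /qdot /= !mul0r !addr0.
case: q => a b c d; rewrite /qdot /= -!expr2 => /eqP.
rewrite !paddr_eq0 ?addr_ge0 ?sqr_ge0 // !sqrf_eq0.
by case/andP => /andP[/andP[/eqP-> /eqP->] /eqP->] /eqP->.
Qed.

Lemma qmul_conjl (R : realType) (q : quat R) : qconj q * q = (qdot q q)%:A.
Proof. by case: q => [????]; congr Quat => /=; rewrite /qdot /=; ring. Qed.

Lemma qmul_conjr (R : realType) (q : quat R) : q * qconj q = (qdot q q)%:A.
Proof. by case: q => [????]; congr Quat => /=; rewrite /qdot /=; ring. Qed.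

Lemma qmulVl (R : realType) :
  {in [pred q : quat R | q != 0], left_inverse 1 (@qinv R) *%R}.
Proof.
move=> q q0; rewrite (_ : qinv q = (qdot q q)^-1 *: qconj q) // -scalerAl qmul_conjl.
by rewrite scalerA mulVf ?scale1r // qdot_eq0.
Qed.

Lemma qmulVr (R : realType) :
  {in [pred q : quat R | q != 0], right_inverse 1 (@qinv R) *%R}.
Proof.
move=> q q0; rewrite (_ : qinv q = (qdot q q)^-1 *: qconj q) // -scalerAr qmul_conjr.
by rewrite scalerA mulVf ?scale1r // qdot_eq0.
Qed.

Lemma qunitP (R : realType) (p q : quat R) : q * p = 1 /\ p * q = 1 -> p != 0.
Proof.
by case=> + _; apply: contra_eqN => /eqP ->; rewrite mulr0 eq_sym oner_eq0.
Qed.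

Lemma qinv_out (R : realType) :
  {in [predC [pred q : quat R | q != 0]], @qinv R =1 id}.
Proof.
move=> q; rewrite !inE negbK => /eqP ->.
by rewrite /qinv; congr Quat => /=; rewrite ?oppr0 mulr0.
Qed.

HB.instance Definition _ (R : realType) :=
  GRing.NzRing_hasMulInverse.Build (quat R)
    (@qmulVl R) (@qmulVr R) (@qunitP R) (@qinv_out R).

Definition qI (R : realType) : quat R := Quat 0 1 0 0.
Definition qJ (R : realType) : quat R := Quat 0 0 1 0.
Definition qK (R : realType) : quat R := Quat 0 0 0 1.

(* Im(H), which is identified with Euclidean 3-space. *)
Definition imaginary (R : realType) (q : quat R) : Prop := q_re q = 0.

(* On imaginary quaternions this is the usual cross product: i x j = k. *)
Definition qcross (R : realType) (u v : quat R) : quat R :=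
  2^-1 *: (u * v - v * u).

(* Right-handed rotation by t about the nonzero imaginary vector a, by
   Rodrigues' formula for the unit vector in the direction of a. *)
Definition rotation (R : realType) (a : quat R) (t : R) (v : quat R) : quat R :=
  let u := (qnorm a)^-1 *: a in
  cos t *: v + sin t *: qcross u v + ((1 - cos t) * qdot u v) *: u.

Definition half_plane (R : realType) (a m : quat R) : set (quat R) :=
  [set x | exists s t : R, 0 < t /\ x = s *: a + t *: m].

(* Cell decompositions of oriented surfaces, by half-edges (darts). A dart is
   an edge together with one of its two orientations; lface d is the face whose
   boundary orientation d carries, and opp d is the same edge with the opposite
   orientation, as carried by the face on its other side. The edges are the
   pairs {d, opp d}. The types may be infinite, so that the surface need not be
   compact.
   - lface_opp and common_edge: each edge lies on two distinct faces, and two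
     adjacent faces have only one edge in common;
   - src_rotation: turning around a vertex from one outgoing dart reaches all
     of them, that is, the faces at a vertex form one finite cycle and a
     neighbourhood of the vertex is a disk. *)
Record oriented_net := OrientedNet {
  vertex : eqType;
  dart : eqType;
  face : eqType;
  src : dart -> vertex;
  opp : dart -> dart;
  lface : dart -> face;
  boundary : face -> seq dart;
  oppK : involutive opp;
  mem_boundary : forall i d, (d \in boundary i) = (lface d == i);
  boundary_uniq : forall i, uniq (boundary i);
  boundary_polygon : forall i, (2 < size (boundary i))%N;
  boundary_cycle :
    forall i, cycle (fun d d' => src (opp d) == src d') (boundary i);
  lface_opp : forall d, lface (opp d) != lface d;
  common_edge : forall d d', lface d = lface d' ->
    lface (opp d) = lface (opp d') -> d = d';
  src_surj : forall v, exists d, src d = v;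
  src_rotation : forall d d', src d = src d' ->
    exists k, d' = iter k (fun c => opp (prev (boundary (lface c)) c)) d;
  net_connected : forall i j, exists2 s : seq face,
    path (fun a b => b \in [seq lface (opp d) | d <- boundary a]) i s &
    last i s = j
}.

Definition dst (X : oriented_net) (d : dart X) : vertex X := src (opp d).

Definition rface (X : oriented_net) (d : dart X) : face X := lface (opp d).

(* A quantity indexed by an ordered pair ij of adjacent faces is a function of
   the dart d with lface d = i and rface d = j, which is unique. By this lemma,
   a sum over the faces j adjacent to i is a sum over d <- boundary i. *)
Lemma rface_boundary_uniq (X : oriented_net) (i : face X) :
  uniq [seq rface d | d <- boundary i].
Proof.
rewrite map_inj_in_uniq ?boundary_uniq // => d d'.
rewrite !mem_boundary => /eqP di /eqP d'i.
by apply: common_edge; rewrite di d'i.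
Qed.

Definition edge_vec (R : realType) (X : oriented_net)
    (f : vertex X -> quat R) (d : dart X) : quat R := f (dst d) - f (src d).

Definition is_dihedral_angle (R : realType) (X : oriented_net)
    (f : vertex X -> quat R) (n : face X -> quat R) (d : dart X) (t : R) :=
  - pi < t < pi /\
  (rotation (edge_vec f d) t @` half_plane (edge_vec f d) (n (lface d)) =
   half_plane (edge_vec f d) (n (rface d)))%classic.

Record fec_net (R : realType) (X : oriented_net)
    (f : vertex X -> quat R) (n : face X -> quat R) : Prop := FecNet {
  fec_f_im : forall v, imaginary (f v);
  fec_n_im : forall i, imaginary (n i);
  fec_n_unit : forall i, qnorm (n i) = 1;
  fec_constraint :
    forall d, qdot (n (lface d) + n (rface d)) (edge_vec f d) = 0;
  fec_edge_neq0 : forall d, edge_vec f d != 0;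
  fec_not_parallel :
    forall d, ~ exists s : R, n (lface d) = s *: edge_vec f d;
  fec_dihedral : forall d, exists t, is_dihedral_angle f n d t
}.

(* In a face-edge-constraint net the angle exists and is unique. *)
Definition dihedral_angle (R : realType) (X : oriented_net)
    (f : vertex X -> quat R) (n : face X -> quat R) (d : dart X) : R :=
  xget 0 [set t | is_dihedral_angle f n d t]%classic.

Definition edge_curvature (R : realType) (X : oriented_net)
    (f : vertex X -> quat R) (n : face X -> quat R) (d : dart X) : R :=
  2^-1 * qnorm (edge_vec f d) * tan (dihedral_angle f n d / 2).

Definition mean_curvature (R : realType) (X : oriented_net)
    (f : vertex X -> quat R) (n : face X -> quat R) (i : face X) : R :=
  \sum_(d <- boundary i) edge_curvature f n d.

Definition hyperedge (R : realType) (X : oriented_net)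
    (f : vertex X -> quat R) (n : face X -> quat R) (d : dart X) : quat R :=
  (2 * edge_curvature f n d)%:A + edge_vec f d.

Definition extrinsic_dirac (R : realType) (X : oriented_net)
    (f : vertex X -> quat R) (n : face X -> quat R)
    (phi : face X -> quat R) : face X -> quat R :=
  fun i => 2^-1 *:
    \sum_(d <- boundary i) hyperedge f n d * (phi (rface d) - phi i).

(* The edge of d as a vector of the plane of the face lface d. *)
Definition intrinsic_edge (R : realType) (X : oriented_net)
    (f : vertex X -> quat R) (n : face X -> quat R) (d : dart X) : quat R :=
  let m := n (lface d) in
  let w := edge_vec f d - qdot (edge_vec f d) m *: m in
  (qnorm (hyperedge f n d) / qnorm w) *: w.

Definition edge_rotation (R : realType) (X : oriented_net)
    (f : vertex X -> quat R) (n : face X -> quat R) (d : dart X) : quat R :=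
  (intrinsic_edge f n d)^-1 * hyperedge f n d.

(* p is an orthonormal frame of the plane perpendicular to m, oriented by m. *)
Record oriented_frame (R : realType) (m : quat R) (p : quat R * quat R) :
    Prop := OrientedFrame {
  frame_im1 : imaginary p.1;
  frame_im2 : imaginary p.2;
  frame_unit1 : qnorm p.1 = 1;
  frame_unit2 : qnorm p.2 = 1;
  frame_orth : qdot p.1 p.2 = 0;
  frame_tangent1 : qdot p.1 m = 0;
  frame_tangent2 : qdot p.2 m = 0;
  frame_oriented : qcross p.1 p.2 = m
}.

Definition frame_edge (R : realType) (X : oriented_net)
    (f : vertex X -> quat R) (n : face X -> quat R)
    (p : face X -> quat R * quat R) (d : dart X) : quat R :=
  qdot (intrinsic_edge f n d) (p (lface d)).1 *: qI R +
  qdot (intrinsic_edge f n d) (p (lface d)).2 *: qJ R.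

(* The unit quaternions g realize the frames p by conjugation. *)
Record frame_lift (R : realType) (X : oriented_net)
    (f : vertex X -> quat R) (n : face X -> quat R)
    (p : face X -> quat R * quat R) (g : face X -> quat R) : Prop := FrameLift {
  lift_unit : forall i, qnorm (g i) = 1;
  lift_edge : forall d, intrinsic_edge f n d =
    (g (lface d))^-1 * frame_edge f n p d * g (lface d);
  lift_normal : forall i, n i = (g i)^-1 * qK R * g i
}.

Definition spinor_connection (R : realType) (X : oriented_net)
    (f : vertex X -> quat R) (n : face X -> quat R) (g : face X -> quat R)
    (d : dart X) : quat R :=
  g (lface d) * edge_rotation f n d * (g (rface d))^-1.

(* A section of the spinor bundle, given by its coordinates in the frames p. *)
Definition spinor_field (R : realType) (X : oriented_net) := face X -> quat R.

(* The intrinsic Dirac operator of edge vectors e and connection h, both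
   written in the frames. *)
Definition intrinsic_dirac (R : realType) (X : oriented_net)
    (e h : dart X -> quat R) (psi : spinor_field R X) : spinor_field R X :=
  fun i => 2^-1 *: \sum_(d <- boundary i) e d * h d * psi (rface d).

Definition curvature_mul (R : realType) (X : oriented_net)
    (f : vertex X -> quat R) (n : face X -> quat R)
    (psi : spinor_field R X) : spinor_field R X :=
  fun i => mean_curvature f n i *: psi i.

(* The section written (c, phi), where c is the constant frame. *)
Definition of_const_frame (R : realType) (X : oriented_net)
    (g : face X -> quat R) (phi : face X -> quat R) : spinor_field R X :=
  fun i => g i * phi i.

(* The map (c, phi) |-> phi. *)
Definition to_const_frame (R : realType) (X : oriented_net)
    (g : face X -> quat R) (psi : spinor_field R X) : face X -> quat R :=
  fun i => (g i)^-1 * psi i.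

Lemma qnorm1_unit (R : realType) (q : quat R) :
  qnorm q = 1 -> q \is a GRing.unit.
Proof.
move=> q1; change (q != 0); apply: contra_eqN q1 => /eqP ->.
rewrite /qnorm; have /eqP -> : qdot (0 : quat R) 0 == 0 by rewrite qdot_eq0.
by rewrite sqrtr0 eq_sym oner_eq0.
Qed.

Lemma of_const_frameK (R : realType) (X : oriented_net) (g : face X -> quat R) :
  (forall i, qnorm (g i) = 1) ->
  cancel (of_const_frame g) (to_const_frame g).
Proof.
move=> g1 phi; apply: funext => i.
by rewrite /to_const_frame mulKr ?qnorm1_unit.
Qed.

Lemma to_const_frameK (R : realType) (X : oriented_net) (g : face X -> quat R) :
  (forall i, qnorm (g i) = 1) ->
  cancel (to_const_frame g) (of_const_frame g).
Proof.
move=> g1 psi; apply: funext => i.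
by rewrite /of_const_frame mulVKr ?qnorm1_unit.
Qed.

Definition const_spinor (R : realType) (X : oriented_net)
    (g : face X -> quat R) : spinor_field R X :=
  of_const_frame g (fun=> 1).

(* Main.v *)
Require Import Defs.
From mathcomp Require Import all_boot all_order all_algebra.
From mathcomp Require Import boolp classical_sets functions reals trigo.

Set Implicit Arguments.
Unset Strict Implicit.
Unset Printing Implicit Defensive.

Import Order.TTheory GRing.Theory Num.Theory.

Local Open Scope ring_scope.

(** In the constant frame the intrinsic Dirac operator is simply
    [phi |-> 1/2 sum_j E_ij phi_j]: on each edge the conjugations by [g_i] and
    [g_j] cancel and what is left is [e * (e^-1 * E) = E]
    ([frame_edge_connection]). Here the intrinsic edge [e] has to be invertible;
    it has the length of the hyperedge, whose imaginary part is the nonzero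
    edge vector, and the direction of the projection of that vector, which is
    nonzero because the normal is not parallel to the edge
    ([intrinsic_edge_unit]).

    The other ingredient is that each face is a closed polygon, so that its edge
    vectors add up to zero and the hyperedges of the face [i] have the real sum
    [2 H_i] ([sum_hyperedge]). Hence [1/2 sum_j E_ij (phi_j - phi_i)] is
    [1/2 sum_j E_ij phi_j - H_i phi_i], which is the conjugate of [D - H], and
    the constant field [1] gives [D phi_c = H phi_c]. *)

Lemma sum_path_telescope (T : eqType) (V : zmodType) (W : eqType)
    (F : W -> V) (a b : T -> W) (x : T) (s : seq T) :
  path (fun d d' => b d == a d') x s ->
  \sum_(d <- x :: s) (F (b d) - F (a d)) = F (b (last x s)) - F (a x).
Proof.
elim: s x => [|y s IHs] x /=; first by rewrite big_seq1.
case/andP => /eqP bx yP; rewrite big_cons (IHs _ yP) bx.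
by rewrite addrC addrA subrK.
Qed.

Lemma sum_cycle_telescope (T : eqType) (V : zmodType) (W : eqType)
    (F : W -> V) (a b : T -> W) (s : seq T) :
  cycle (fun d d' => b d == a d') s ->
  \sum_(d <- s) (F (b d) - F (a d)) = 0.
Proof.
case: s => [|x s] /=; first by rewrite big_nil.
rewrite rcons_path => /andP[xP /eqP bx].
by rewrite (sum_path_telescope _ xP) bx subrr.
Qed.

Lemma qnorm_eq0 (R : realType) (q : quat R) : (qnorm q == 0) = (q == 0).
Proof.
rewrite /qnorm sqrtr_eq0 -qdot_eq0 eq_le.
by rewrite [X in _ && X](_ : _ = true) ?andbT // /qdot -!expr2 !addr_ge0 ?sqr_ge0.
Qed.

Lemma qnorm1_conj (R : realType) (q : quat R) : qnorm q = 1 -> qconj q = q^-1.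
Proof.
move=> q1; apply: (mulIr (qnorm1_unit q1)).
rewrite mulVr ?qnorm1_unit // qmul_conjl.
have -> : qdot q q = 1.
  by rewrite -[LHS]sqr_sqrtr -/(qnorm q) ?q1 ?expr1n // /qdot -!expr2 !addr_ge0 ?sqr_ge0.
by rewrite scale1r.
Qed.

Section Net.
Variables (R : realType) (X : oriented_net).
Variables (f : vertex X -> quat R) (n : face X -> quat R).

Lemma sum_edge_vec (i : face X) : \sum_(d <- boundary i) edge_vec f d = 0.
Proof. exact: sum_cycle_telescope (boundary_cycle i). Qed.

(** The edge vectors of the closed polygon cancel; only the real parts of the
    hyperedges remain. *)
Lemma sum_hyperedge (i : face X) :
  2^-1 *: \sum_(d <- boundary i) hyperedge f n d = (mean_curvature f n i)%:A.
Proof.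
rewrite big_split /= sum_edge_vec addr0 -scaler_suml scalerA -mulr_sumr.
by rewrite mulKf // pnatr_eq0.
Qed.

Lemma extrinsic_diracE (phi : face X -> quat R) (i : face X) :
  extrinsic_dirac f n phi i =
  2^-1 *: \sum_(d <- boundary i) hyperedge f n d * phi (rface d)
    - mean_curvature f n i *: phi i.
Proof.
rewrite /extrinsic_dirac; under eq_bigr do rewrite mulrBr.
rewrite sumrB scalerBr; congr (_ - _).
by rewrite -mulr_suml scalerAl sum_hyperedge -scalerAl mul1r.
Qed.

Hypothesis fec : fec_net f n.

(** The imaginary part of the hyperedge is the edge vector. *)
Lemma hyperedge_neq0 (d : dart X) : hyperedge f n d != 0.
Proof.
apply: contra_neq (fec_edge_neq0 fec d) => E0.
have edge_im : imaginary (edge_vec f d).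
  by rewrite /imaginary /= !(fec_f_im fec) subr0.
move: E0 edge_im; rewrite /hyperedge /imaginary.
case: (edge_vec f d) => a b c e [_ + + +] /= ->.
by rewrite !mulr0 !add0r => -> -> ->.
Qed.

(** If it vanished, the edge vector would be a multiple [s n_i] of the normal,
    with [s != 0], and [n_i] would be parallel to the edge. *)
Lemma tangent_part_neq0 (d : dart X) :
  edge_vec f d - qdot (edge_vec f d) (n (lface d)) *: n (lface d) != 0.
Proof.
apply/negP; rewrite subr_eq0; set s := qdot _ _ => /eqP edgeE.
apply: (fec_not_parallel fec (d := d)).
exists s^-1; rewrite edgeE scalerA mulVf ?scale1r //.
apply: contra_neq (fec_edge_neq0 fec d) => s0.
by rewrite edgeE s0 scale0r.
Qed.

Lemma intrinsic_edge_unit (d : dart X) :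
  intrinsic_edge f n d \is a GRing.unit.
Proof.
change (intrinsic_edge f n d != 0).
rewrite /intrinsic_edge scaler_eq0 mulf_eq0 invr_eq0 !qnorm_eq0.
by rewrite !(negPf (tangent_part_neq0 d)) (negPf (hyperedge_neq0 d)).
Qed.

Variables (p : face X -> quat R * quat R) (g : face X -> quat R).
Hypothesis lift : frame_lift f n p g.

Let g_unit i : g i \is a GRing.unit := qnorm1_unit (lift_unit lift i).

(** The frames cancel, and the connection carries the intrinsic edge to the
    hyperedge: [(g_i e g_i^-1) (g_i e^-1 E g_j^-1) g_j = g_i E]. *)
Lemma frame_edge_connection (d : dart X) :
  frame_edge f n p d * spinor_connection f n g d * g (rface d) =
  g (lface d) * hyperedge f n d.
Proof.
have -> : frame_edge f n p d =
    g (lface d) * intrinsic_edge f n d * (g (lface d))^-1.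
  by rewrite (lift_edge lift) !mulrA divrr // mul1r mulrK.
rewrite /spinor_connection /edge_rotation !mulrA mulrVK // mulrVK //.
by rewrite mulrK // intrinsic_edge_unit.
Qed.

Lemma intrinsic_dirac_const_frame (phi : face X -> quat R) (i : face X) :
  intrinsic_dirac (frame_edge f n p) (spinor_connection f n g)
    (of_const_frame g phi) i =
  g i * (2^-1 *: \sum_(d <- boundary i) hyperedge f n d * phi (rface d)).
Proof.
rewrite /intrinsic_dirac /of_const_frame -scalerAr mulr_sumr; congr (_ *: _).
apply: eq_big_seq => d; rewrite mem_boundary => /eqP <-.
by rewrite [LHS]mulrA frame_edge_connection -mulrA.
Qed.

End Net.

Theorem mainTheorem8 (R : realType) (X : oriented_net)
    (f : vertex X -> quat R) (n : face X -> quat R)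
    (p : face X -> quat R * quat R) (g : face X -> quat R)
    (fec : fec_net f n)
    (frames : forall i, oriented_frame (n i) (p i))
    (lift : frame_lift f n p g) :
  let D := intrinsic_dirac (frame_edge f n p) (spinor_connection f n g) in
  let H := curvature_mul f n in
  let phi_c := const_spinor g in
  [/\ D phi_c = H phi_c,
      forall d : dart X,
        qconj (g (lface d)) * frame_edge f n p d * spinor_connection f n g d
          * g (rface d) = hyperedge f n d,
      forall i : face X, (g i)^-1 * qK R * g i = n i &
      to_const_frame g \o (D \- H) \o of_const_frame g = extrinsic_dirac f n].
Proof.
move=> D H phi_c; split.
- apply: funext => i; rewrite /D /phi_c /const_spinor.
  rewrite (intrinsic_dirac_const_frame fec lift).
  under eq_bigr do rewrite mulr1.
  by rewrite sum_hyperedge /H /curvature_mul /of_const_frame mulr1 -scalerAr mulr1.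
- move=> d; rewrite -2!mulrA [_ * (_ * g _)]mulrA (frame_edge_connection fec lift).
  by rewrite qnorm1_conj ?mulKr ?qnorm1_unit ?(lift_unit lift).
- by move=> i; rewrite -(lift_normal lift).
- apply: funext => phi; apply: funext => i; rewrite extrinsic_diracE.
  set psi := of_const_frame g phi.
  rewrite -[LHS]/((g i)^-1 * (D psi i - H psi i)) /D /psi.
  rewrite (intrinsic_dirac_const_frame fec lift) /H /curvature_mul /of_const_frame.
  by rewrite scalerAr -mulrBr mulKr // qnorm1_unit ?(lift_unit lift).
Qed.
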